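(* Let $L$ be a coherent frame. Then $L$ is a Heyting frame if and only if the bounded sublattice $K(L)$ of $L$, with the order inherited from $L$, is a Heyting algebra.
   Context: For a frame $L$, an element $a$ is compact if $a\le\bigvee S$ implies $a\le\bigvee T$ for some finite $T\subseteq S$; $K(L)$ denotes the set of compact elements of $L$. A frame $L$ is coherent if every element is a join of compact elements and $K(L)$ is a bounded sublattice of $L$. A frame $L$ is a Heyting frame if $K(L)$ is a Heyting subalgebra of $L$, i.e. $K(L)$ contains $0,1$ and is closed under finite meets, finite joins, and the Heyting implication $\to$ of the frame $L$ (every frame is a complete Heyting algebra). *)

(* Defs.v *)
From HB Require Import structures.
From mathcomp Require Import all_boot all_order.
From mathcomp Require Import boolp classical_sets cardinality.

Set Implicit Arguments.
Unset Strict Implicit.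
Unset Printing Implicit Defensive.

Import Order.TTheory.

Local Open Scope order_scope.

(* In a lattice with bottom, [supremum \bot S] is the join of S whenever that
   join exists; the default value \bot is also the join of the empty set. *)
Definition bigjoin d (L : bLatticeType d) (S : set L) : L := supremum \bot S.
Arguments bigjoin {d L} S%_classic.

HB.mixin Record TBLattice_isFrame d (L : Type) of Order.TBLattice d L := {
  supremums_neq0 : forall S : set L, (supremums S !=set0)%classic;
  meet_bigjoinr : forall (a : L) (S : set L),
    a `&` bigjoin S = bigjoin [set a `&` s | s in S]
}.

#[short(type="frameType")]
HB.structure Definition Frame d :=
  {L of TBLattice_isFrame d L & Order.TBLattice d L}.

Section FrameTheory.
Context {d : Order.disp_t} {L : frameType d}.
Implicit Types (a b x : L) (S T : set L).

Lemma bigjoin_supremums S : supremums S (bigjoin S).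
Proof.
rewrite /bigjoin /supremum; case: ifPn => [/eqP ->|_].
  by split=> // x _; exact: le0x.
by case: xgetP => // noS; have [x /noS] := supremums_neq0 S.
Qed.

Lemma bigjoin_le S x : bigjoin S <= x <-> ubound S x.
Proof.
have [ubS lubS] := bigjoin_supremums S; split=> [le_x s Ss|]; last exact: lubS.
exact: le_trans (ubS s Ss) le_x.
Qed.

Definition himp a b : L := bigjoin [set x | a `&` x <= b].

Lemma le_himp a b x : (x <= himp a b) = (a `&` x <= b).
Proof.
apply/idP/idP => [le_x|le_b].
  apply: le_trans (leI2 (lexx a) le_x) _.
  by rewrite meet_bigjoinr; apply/bigjoin_le => _ [y /= le_b <-].
by have [ubS _] := bigjoin_supremums [set y | a `&` y <= b]; exact: ubS.
Qed.

Definition compact_elt a : Prop :=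
  forall S, a <= bigjoin S ->
    exists T, [/\ finite_set T, (T `<=` S)%classic & a <= bigjoin T].

Definition compactb : {pred L} := fun a => `[< compact_elt a >].

Definition heyting_frame : Prop :=
  [/\ \bot \in compactb, \top \in compactb, meet_closed compactb,
      join_closed compactb & {in compactb &, forall a b, himp a b \in compactb}].

End FrameTheory.

Arguments heyting_frame {d} L.
Arguments compactb {d} L.

Definition heyting_algebra d (H : tbLatticeType d) : Prop :=
  exists imp : H -> H -> H,
    forall a b x : H, (x <= imp a b) = (a `&` x <= b).

Lemma frame_heyting_algebra d (L : frameType d) : heyting_algebra L.
Proof. by exists himp; exact: le_himp. Qed.

HB.mixin Record Frame_isCoherent d (L : Type) of Frame d L := {
  bigjoin_compact : forall a : L,
    exists2 S : set L, (forall s, S s -> compact_elt s) & a = bigjoin S;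
  compactI : meet_closed (compactb L);
  compactU : join_closed (compactb L);
  compact0 : \bot \in compactb L;
  compact1 : \top \in compactb L
}.

#[short(type="coherentFrameType")]
HB.structure Definition CoherentFrame d :=
  {L of Frame_isCoherent d L & Frame d L}.

Definition K d (L : frameType d) : Type := {a : L | compactb L a}.

HB.instance Definition _ d (L : frameType d) := SubChoice.on (K L).
HB.instance Definition _ d (L : coherentFrameType d) :=
  Order.SubChoice_isTBSubLattice.Build d L (compactb L) d (K L)
    compactI compactU compact0 compact1.

Lemma le_K d (L : coherentFrameType d) (a b : K L) :
  (a <= b) = (val a <= val b).
Proof. by rewrite Order.le_val. Qed.

(* Main.v *)
(* In a coherent frame an element is determined by the compact elements below
   it.  Hence an implication on K(L), characterized by its adjunction against
   compact elements only, must agree with the implication of L. *)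

Require Import Defs.
From mathcomp Require Import all_boot all_order.
From mathcomp Require Import boolp.

Import Order.TTheory.
Local Open Scope order_scope.

(** By coherence [a] is a join of compact elements; each one is an admissible test [x], so [b]
    bounds the whole join. *)
Lemma compact_le d (L : coherentFrameType d) (a b : L) :
  (forall x : K L, val x <= a -> val x <= b) -> a <= b.
Proof.
have [S cptS ->] := bigjoin_compact a => le_b.
apply/bigjoin_le => s Ss.
have cs : s \in compactb L by apply/asboolP/cptS.
have [ubS _] := bigjoin_supremums S.
by apply: (le_b (Sub s cs)); rewrite SubK; exact: ubS.
Qed.

Lemma meet_le_K d (L : coherentFrameType d) (a b x : K L) :
  (a `&` x <= b) = (val a `&` val x <= val b).
Proof. by rewrite le_K. Qed.

Lemma val_K_imp d (L : coherentFrameType d) (imp : K L -> K L -> K L) :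
  (forall a b x : K L, (x <= imp a b) = (a `&` x <= b)) ->
  forall a b : K L, val (imp a b) = himp (val a) (val b).
Proof.
move=> impP a b; apply/le_anti/andP; split.
  by rewrite le_himp -meet_le_K -impP.
(* [himp (val a) (val b)] is not yet known to be compact, so it is compared through the compact
   elements below it. *)
by apply: compact_le => x; rewrite le_himp -meet_le_K -impP le_K.
Qed.

Theorem theorem3p2 (d : Order.disp_t) (L : coherentFrameType d) :
  heyting_frame L <-> heyting_algebra (K L).
Proof.
split=> [[_ _ _ _ cpt_himp]|[imp impP]].
  exists (fun a b => Sub (himp (val a) (val b)) (cpt_himp _ _ (valP a) (valP b))).
  by move=> a b x; rewrite le_K SubK le_himp meet_le_K.
split; [exact: compact0|exact: compact1|exact: compactI|exact: compactU|].
(* The implication in [L] of two compact elements is the value of an element of [K L], hence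
   compact. *)
move=> a b ca cb; have := val_K_imp _ _ _ impP (Sub a ca) (Sub b cb).
by rewrite !SubK => <-; exact: valP.
Qed.
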